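(* For every integer $n\ge1$, $$\sum_{P\in\mathcal{M}_n}q^{\operatorname{blocks}(P)}=\sum_{t=1}^{\lfloor (n+1)/2\rfloor}\binom{n-1}{2(t-1)}q^t,$$ where $\mathcal{M}_n$ is the set of non-crossing merging-free partitions of $[n]$ and $\operatorname{blocks}(P)$ is the number of blocks of $P$.
   Context: A set partition $P=B_1/\cdots/B_k$ of $[n]$ in block representation has blocks ordered by increasing minima. $P$ is merging-free if $\max B_i>\min B_{i+1}$ for $1\le i\le k-1$. $P$ is non-crossing if there are no $a<x<b<y$ with $a,b$ in one block and $x,y$ in a different block. *)

(* Defs.v *)
From HB Require Import structures.
From mathcomp Require Import all_boot all_order all_algebra.
Set Implicit Arguments.
Unset Strict Implicit.
Unset Printing Implicit Defensive.

(* The ground set [n] = {1, ..., n} is represented by 'I_n = {0, ..., n - 1}: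
   every notion below depends only on the order of the elements. *)

(* For nonempty B the default n is larger than every element of B. *)
Definition block_min (n : nat) (B : {set 'I_n}) : nat :=
  \big[minn/n]_(i in B) (i : nat).

Definition block_max (n : nat) (B : {set 'I_n}) : nat :=
  \max_(i in B) (i : nat).

Definition block_rep (n : nat) (P : {set {set 'I_n}}) : seq {set 'I_n} :=
  sort (fun A B => block_min A <= block_min B) (enum P).

(* Indices are shifted by one: nth set0 (block_rep P) i is B_(i+1). *)
Definition merging_free (n : nat) (P : {set {set 'I_n}}) : bool :=
  [forall i : 'I_(size (block_rep P)).-1,
     block_max (nth set0 (block_rep P) i)
       > block_min (nth set0 (block_rep P) i.+1)].

Definition non_crossing (n : nat) (P : {set {set 'I_n}}) : bool :=
  ~~ [exists A in P, exists B in P, (A != B) &&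
       [exists a in A, exists b in A, exists x in B, exists y in B,
          [&& a < x, x < b & b < y]]].

Definition nc_merging_free (n : nat) : {set {set {set 'I_n}}} :=
  [set P | [&& partition P [set: 'I_n], non_crossing P & merging_free P]].

Definition blocks (n : nat) (P : {set {set 'I_n}}) : nat := #|P|.

(* Main.v *)
(** In a non-crossing merging-free partition the block [B_(i+1)] starts between
    the extremes of [B_i], hence by non-crossing lies entirely between them. So
    the intervals [[min B_i, max B_i]] form a nested chain, and the index of the
    block of [x], as a function of [x], climbs from 0 by steps of at most 1 and
    then goes back down to 0 in the same way. Such a function is determined by
    the set [S] of the positions [s] where it changes between [s] and [s + 1],
    which has even size [2 (k - 1)] for [k] blocks. Conversely, any even set [S]
    of the [n - 1] positions gives the index function
    [x |-> min (r x) (#|S| - r x)], where [r x] counts the elements of [S]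
    below [x]. *)

Require Import Defs.
From HB Require Import structures.
From mathcomp Require Import all_boot all_order all_algebra.
From mathcomp Require Import zify.
Set Implicit Arguments.
Unset Strict Implicit.
Unset Printing Implicit Defensive.
Import GRing.Theory.

(** * Rank and level functions of a set of cuts *)

Definition cut_rank (N : nat) (S : {set 'I_N}) (x : nat) : nat :=
  \sum_(s in S) (s < x).

Definition level (N : nat) (S : {set 'I_N}) (x : nat) : nat :=
  minn (cut_rank S x) (#|S| - cut_rank S x).

Section CutRank.
Variables (N : nat) (S : {set 'I_N}).

Lemma cut_rank0 : cut_rank S 0 = 0.
Proof. by rewrite /cut_rank big1. Qed.

Lemma cut_rank_ge x : N <= x -> cut_rank S x = #|S|.
Proof.
move=> leNx; rewrite -sum1_card; apply: eq_bigr => s _.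
by rewrite (leq_trans (ltn_ord s)).
Qed.

Lemma cut_rankS (s : 'I_N) : cut_rank S s.+1 = cut_rank S s + (s \in S).
Proof.
have split_lt (i : 'I_N) : (i < s.+1 : nat) = (i < s) + (i == s).
  by rewrite -val_eqE /=; lia.
rewrite /cut_rank (eq_bigr _ (fun i _ => split_lt i)) big_split /=; congr (_ + _).
case: (boolP (s \in S)) => [sS | sNS].
  by rewrite (bigD1 s) //= eqxx big1 // => i /andP[_ /negPf->].
by rewrite big1 // => i iS; case: eqP => // eis; rewrite -eis iS in sNS.
Qed.

Lemma leq_cut_rank x y : x <= y -> cut_rank S x <= cut_rank S y.
Proof. by move=> lexy; apply: leq_sum => s _; lia. Qed.

Lemma cut_rank_max x : cut_rank S x <= #|S|.
Proof. by rewrite -sum1_card; apply: leq_sum => s _; case: (_ < _). Qed.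

(** A discrete intermediate value argument: the rank starts at 0, grows by at most 1 per step and
    ends at [#|S|]. *)
Lemma cut_rank_surj r : r <= #|S| -> exists x : 'I_N.+1, cut_rank S x = r.
Proof.
move=> le_rS.
have ivt y : y <= N -> r <= cut_rank S y -> exists x : 'I_N.+1, cut_rank S x = r.
  elim: y => [|y IHy] leyN ler.
    by exists ord0; move: ler; rewrite cut_rank0; lia.
  case: (leqP r (cut_rank S y)) => [/(IHy (ltnW leyN)) // | ltr].
  exists (Ordinal (leyN : y.+1 < N.+1)) => /=.
  by move: ler; rewrite (cut_rankS (Ordinal leyN)) /=; case: (_ \in S); lia.
by apply: (ivt N) => //; rewrite cut_rank_ge.
Qed.

Lemma level_max x : level S x <= #|S|./2.
Proof. by rewrite /level; lia. Qed.

Hypothesis even_S : ~~ odd #|S|.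

Lemma level_surj i : i <= #|S|./2 -> exists x : 'I_N.+1, level S x = i.
Proof.
move=> lei; have [|x rx] := @cut_rank_surj i; first lia.
by exists x; rewrite /level rx; lia.
Qed.

(* The level and the rank have the same parity because #|S| is even. *)
Lemma level_stepE (s : 'I_N) : (level S s != level S s.+1) = (s \in S).
Proof.
move: (cut_rank_max s) (cut_rank_max s.+1); rewrite /level cut_rankS.
rewrite -(even_halfK even_S).
by case: (s \in S) => /=; rewrite ?addn0 ?eqxx // => ? ?; apply/eqP; lia.
Qed.

End CutRank.

(** Up to the peak [p] the rank and [F] grow together. After it each change raises the rank and
    lowers [F] by 1, so their sum stays [(F p).*2], which is [#|S|] because [F N = 0]. Hence [F x]
    is the rank before [p] and its complement after [p], in both cases the smaller of the two. *)
Lemma level_unimodal (N p : nat) (F : nat -> nat) (S : {set 'I_N}) :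
    F 0 = 0 -> F N = 0 -> p <= N ->
    (forall x, x < p -> F x.+1 = F x \/ F x.+1 = (F x).+1) ->
    (forall x, p <= x < N -> F x.+1 = F x \/ F x = (F x.+1).+1) ->
    (forall s : 'I_N, (s \in S) = (F s != F s.+1)) ->
  ~~ odd #|S| /\ (forall x, x <= N -> level S x = F x).
Proof.
move=> F0 FN lepN up down SE.
have rankS x : x < N -> cut_rank S x.+1 = cut_rank S x + (F x != F x.+1).
  by move=> ltxN; rewrite (cut_rankS S (Ordinal ltxN)) SE.
have rank_up x : x <= p -> cut_rank S x = F x.
  elim: x => [|x IHx] lexp; first by rewrite cut_rank0 F0.
  by rewrite rankS ?IHx; [case: (up x lexp); lia | lia | lia].
have rank_down d : p + d <= N -> cut_rank S (p + d) + F (p + d) = (F p).*2.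
  elim: d => [|d IHd] led; first by rewrite addn0 rank_up // addnn.
  rewrite addnS rankS; last lia.
  by have := IHd (ltac:(lia)); case: (down (p + d)) => [|e|e]; lia.
have cardS : #|S| = (F p).*2.
  have := rank_down (N - p); rewrite subnKC // FN addn0 => <- //.
  by rewrite cut_rank_ge.
split=> [|x lexN]; first by rewrite cardS odd_double.
have le_up q : q <= p -> F (p - q) <= F p.
  elim: q => [|q IHq] leq; first by rewrite subn0.
  have e : (p - q.+1).+1 = p - q by lia.
  have := up (p - q.+1); rewrite e => /(_ ltac:(lia)).
  by have := IHq (ltac:(lia)); lia.
rewrite /level cardS; case: (leqP x p) => [lexp | ltpx].
  by rewrite rank_up //; have := le_up (p - x); rewrite subKn //; lia.
have := rank_down (x - p); rewrite (subnKC (ltnW ltpx)) => /(_ lexN) rankx.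
by have := leq_cut_rank S (ltnW ltpx); rewrite (rank_up p) //; lia.
Qed.

(** * Labellings by nested blocks: [F] is the block index, [m] and [M] give the block extremes *)

Section NestedLabelling.
Variables (N k : nat) (F m M : nat -> nat).
Hypothesis F_bound : forall x, x <= N -> [/\ F x < k, m (F x) <= x & x <= M (F x)].
Hypothesis m_label : forall i, i < k -> m i <= N /\ F (m i) = i.
Hypothesis M_label : forall i, i < k -> M i <= N /\ F (M i) = i.
Hypothesis m_incr : forall i j, i < j -> j < k -> m i < m j.
Hypothesis merge_free : forall i, i.+1 < k -> m i.+1 < M i.
Hypothesis nc : forall a x b y, a < x -> x < b -> b < y -> y <= N ->
  F a = F b -> F x = F y -> F a = F x.

(** Block [j.+1] starts before block [j] ends. If it also ended later, the extremes
    [m j < m j.+1 < M j < M j.+1] would form a crossing. *)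
Lemma M_decr i j : i < j -> j < k -> M j < M i.
Proof.
elim: j => // j IHj; rewrite ltnS leq_eqVlt => ij ltjk.
have Mj : M j.+1 < M j.
  have [lemj Fmj] := m_label (ltnW ltjk); have [lemj1 Fmj1] := m_label ltjk.
  have [leMj FMj] := M_label (ltnW ltjk); have [leMj1 FMj1] := M_label ltjk.
  have ltm := m_incr (ltnSn j) ltjk; have ltmM := merge_free ltjk.
  case: (ltngtP (M j.+1) (M j)) => // [ltM | eqM].
    by have := nc ltm ltmM ltM leMj1; rewrite Fmj FMj Fmj1 FMj1; lia.
  by move: FMj; rewrite -eqM FMj1; lia.
by case/orP: ij => [/eqP->// | ltij]; apply: ltn_trans Mj (IHj ltij (ltnW ltjk)).
Qed.

Lemma M_decr_leq i j : i <= j -> j < k -> M j <= M i.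
Proof.
by rewrite leq_eqVlt => /orP[/eqP-> // | ltij /(M_decr ltij)/ltnW].
Qed.

Lemma m_incr_leq i j : i <= j -> j < k -> m i <= m j.
Proof.
by rewrite leq_eqVlt => /orP[/eqP-> // | ltij /(m_incr ltij)/ltnW].
Qed.

(* An element of an outer block strictly between the extremes of an inner
   block would cross it. *)
Lemma no_outer_inside i x : i < k -> x <= N -> m i < x -> x < M i -> i <= F x.
Proof.
move=> ltik lexN ltmx ltxM; rewrite leqNgt; apply/negP => ltFi.
have [ltFk lemx _] := F_bound lexN; have [lemN Fm] := m_label ltFk.
have [leiN Fmi] := m_label ltik; have [leMN FMi] := M_label ltik.
by have := nc (m_incr ltFi ltik) ltmx ltxM leMN; rewrite Fm Fmi FMi; lia.
Qed.

(** Before the innermost block starts, no block has ended. A descent would put [x.+1], from an outer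
    block, inside the block of [x]. A jump by 2 or more would force block [(F x).+1] to start
    exactly at [x], which has another label. *)
Lemma nested_step_up x : x < m k.-1 -> F x.+1 = F x \/ F x.+1 = (F x).+1.
Proof.
move=> ltxp; have k_gt0 : 0 < k by have [] := F_bound (leq0n N); lia.
have ltk : k.-1 < k by rewrite prednK.
have [lepN Fp] := m_label ltk.
have [ltFk lem leM] := F_bound (leq_trans (ltnW ltxp) lepN).
have [ltFk1 lem1 leM1] := F_bound (leq_trans ltxp lepN).
have [_ pM] := F_bound lepN; rewrite Fp => lepM.
have ltxM j : j < k -> x < M j.
  by move=> ltjk; have := @M_decr_leq j k.-1; lia.
have nmx j : j < k -> F x < j -> x <= m j.
  move=> ltjk ltFj; rewrite leqNgt; apply/negP => ltm.
  by have := no_outer_inside ltjk _ ltm (ltxM j ltjk); lia.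
case: (ltngtP (F x.+1) (F x)) => [ltF | ltF | ->]; last by left.
  have := no_outer_inside ltFk (leq_trans ltxp lepN); have := ltxM _ ltFk.
  have [_ FM] := M_label ltFk; case: (ltngtP x.+1 (M (F x))) => [||eM]; try lia.
  by move: ltF; rewrite {1}eM FM; lia.
right; apply/eqP; rewrite eqn_leq ltF andbT leqNgt; apply/negP => ltF2.
have ltF1k : (F x).+1 < k by lia.
have := nmx _ ltF1k (ltnSn _); have := m_incr ltF2 ltFk1.
have [_ Fm1] := m_label ltF1k => lt1 le1.
have e : x = m (F x).+1 by lia.
by move: Fm1; rewrite -e; lia.
Qed.

(** The mirror image of the ascent: once the innermost block has started, all blocks have, and the
    order of the maxima replaces that of the minima. *)
Lemma nested_step_down x : m k.-1 <= x < N -> F x.+1 = F x \/ F x = (F x.+1).+1.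
Proof.
case/andP=> lepx ltxN.
have [ltFk lem leM] := F_bound (ltnW ltxN).
have [ltFk1 lem1 leM1] := F_bound ltxN.
have ltmx j : j < k -> m j <= x.
  by move=> ltjk; have := @m_incr_leq j k.-1; lia.
have Mx j : j < k -> F x.+1 < j -> M j <= x.+1.
  move=> ltjk ltFj; rewrite leqNgt; apply/negP => ltM.
  by have := no_outer_inside ltjk ltxN (ltmx j ltjk) ltM; lia.
have ltMx j : j < k -> F x.+1 < j -> M j <= x.
  move=> ltjk ltFj; have := Mx j ltjk ltFj; rewrite leq_eqVlt => /orP[/eqP e|//].
  by have [_] := M_label ltjk; rewrite e; lia.
case: (ltngtP (F x.+1) (F x)) => [ltF | ltF | ->]; last by left.
  right; apply/eqP; rewrite eqn_leq ltF andbT leqNgt; apply/negP => ltF2.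
  have ltF1k : (F x.+1).+1 < k by lia.
  by have := ltMx _ ltF1k (ltnSn _); have := M_decr ltF2 ltFk; lia.
have := no_outer_inside ltFk1 (ltnW ltxN); have := ltmx _ ltFk1.
have [_ Fm] := m_label ltFk1; case: (ltngtP (m (F x.+1)) x) => [||em]; try lia.
by have Fx : F x = F x.+1 by [rewrite -{1}em Fm]; lia.
Qed.

Lemma nested_ends : F 0 = 0 /\ F N = 0.
Proof.
have [lt0k le0 _] := F_bound (leq0n N); have [ltNk _ leN] := F_bound (leqnn N).
have k_gt0 : 0 < k by lia.
have [leM0 _] := M_label k_gt0.
split.
  by case: (posnP (F 0)) => // lt0; have := m_incr lt0 lt0k; lia.
by case: (posnP (F N)) => // lt0; have := M_decr lt0 ltNk; lia.
Qed.

Lemma nested_level (S : {set 'I_N}) :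
    (forall s : 'I_N, (s \in S) = (F s != F s.+1)) ->
  ~~ odd #|S| /\ (forall x, x <= N -> level S x = F x).
Proof.
move=> SE; have [F0 FN] := nested_ends.
have [ltFk _ _] := F_bound (leq0n N).
have [|lepN _] := @m_label k.-1; first lia.
exact: (level_unimodal F0 FN lepN nested_step_up nested_step_down SE).
Qed.

End NestedLabelling.

(** * Block extremes, the block representation and crossings *)

Section BlockExtremes.
Variables (n : nat) (B : {set 'I_n}).

Lemma block_min_le (x : 'I_n) : x \in B -> block_min B <= x.
Proof.
move=> xB; rewrite /block_min; have := mem_index_enum x.
elim: (index_enum _) => //= i r IHr; rewrite inE big_cons => /predU1P[<- | /IHr le_r].
  by rewrite xB geq_minl.
by case: ifP => // _; rewrite geq_min le_r orbT.
Qed.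

Lemma block_max_ge (x : 'I_n) : x \in B -> x <= block_max B.
Proof. by move=> xB; apply: leq_bigmax_cond. Qed.

Lemma block_min_in : B != set0 -> exists2 y, y \in B & block_min B = y.
Proof.
case/set0Pn=> x xB.
(* The default [n] of the iterated minimum is carried along as an alternative, then refuted because
   [x] in [B] is below [n]. *)
have: block_min B = n \/ exists2 y, y \in B & block_min B = y.
  rewrite /block_min; apply: (big_ind (fun v => v = n \/ exists2 y, y \in B & v = y)).
  - by left.
  - by move=> u v Hu Hv; rewrite /minn; case: ifP.
  - by move=> i iB; right; exists i.
by case=> // e; have := block_min_le xB; rewrite e; have := ltn_ord x; lia.
Qed.

Lemma block_max_in : B != set0 -> exists2 y, y \in B & block_max B = y.
Proof.
move=> B0; have [|y yB e] := @eq_bigmax_cond _ [in B] (@nat_of_ord n).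
  by rewrite card_gt0.
by exists y.
Qed.

End BlockExtremes.

Section BlockRep.
Variables (n : nat) (P : {set {set 'I_n}}).

Lemma mem_block_rep A : (A \in block_rep P) = (A \in P).
Proof. by rewrite mem_sort mem_enum. Qed.

Lemma block_rep_uniq : uniq (block_rep P).
Proof. by rewrite sort_uniq enum_uniq. Qed.

Lemma merging_freeP :
  reflect (forall i, i.+1 < size (block_rep P) ->
     block_min (nth set0 (block_rep P) i.+1) < block_max (nth set0 (block_rep P) i))
    (merging_free P).
Proof.
apply: (iffP forallP) => [mf i lti | mf i]; last by apply: mf; have := ltn_ord i; lia.
have lti' : i < (size (block_rep P)).-1 by lia.
exact: (mf (Ordinal lti')).
Qed.

Hypothesis partP : partition P [set: 'I_n].

Lemma block_neq0 A : A \in P -> A != set0.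
Proof.
by move=> AP; apply: contraTneq AP => ->; case/and3P: partP.
Qed.

Lemma pblock_block A x : A \in P -> x \in A -> pblock P x = A.
Proof. by case/and3P: partP => _ tI _; apply: def_pblock. Qed.

Lemma mem_pblock_part x : x \in pblock P x.
Proof. by rewrite mem_pblock (cover_partition partP) in_setT. Qed.

Lemma pblock_in_part x : pblock P x \in P.
Proof. by rewrite pblock_mem // (cover_partition partP) in_setT. Qed.

(** A minimum belongs to its block and blocks are disjoint. This makes the sorted order of
    [block_rep] strict. *)
Lemma block_min_inj : {in P &, injective (@block_min n)}.
Proof.
move=> A B AP BP e.
have [x xA ex] := block_min_in (block_neq0 AP).
have [y yB ey] := block_min_in (block_neq0 BP).
have exy : x = y by apply: val_inj; rewrite /= -ex -ey.
by rewrite -(pblock_block AP xA) exy (pblock_block BP yB).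
Qed.

Lemma block_rep_min_lt i j : i < j -> j < size (block_rep P) ->
  block_min (nth set0 (block_rep P) i) < block_min (nth set0 (block_rep P) j).
Proof.
move=> ltij ltj; have lti := ltn_trans ltij ltj.
rewrite ltn_neqAle; apply/andP; split; last first.
  have tr : transitive (fun A B : {set 'I_n} => block_min A <= block_min B).
    by move=> B A C; apply: leq_trans.
  have srt : sorted (fun A B : {set 'I_n} => block_min A <= block_min B) (block_rep P).
    by apply: sort_sorted => A B; apply: leq_total.
  exact: (sorted_ltn_nth tr set0 srt i j lti ltj ltij).
apply/eqP => e; have := @block_min_inj _ _ _ _ e.
rewrite -!mem_block_rep !mem_nth // => /(_ isT isT)/eqP.
by rewrite nth_uniq ?block_rep_uniq // ltn_eqF.
Qed.

(** Blocks are named through their elements, the form that the labelling hypothesis [nc] takes once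
    [F] is the block index. *)
Lemma non_crossingP :
  reflect (forall a x b y : 'I_n, a < x -> x < b -> b < y ->
      pblock P a = pblock P b -> pblock P x = pblock P y -> pblock P a = pblock P x)
    (non_crossing P).
Proof.
apply: (iffP idP) => [nc a x b y ltax ltxb ltby eab exy | nc].
  apply/eqP; apply: contraNT nc => neq.
  apply/existsP; exists (pblock P a); rewrite pblock_in_part /=.
  apply/existsP; exists (pblock P x); rewrite pblock_in_part neq /=.
  apply/existsP; exists a; rewrite mem_pblock_part /=.
  apply/existsP; exists b; rewrite eab mem_pblock_part /=.
  apply/existsP; exists x; rewrite mem_pblock_part /=.
  by apply/existsP; exists y; rewrite exy mem_pblock_part ltax ltxb ltby.
apply/negP => /existsP[A /andP[AP /existsP[B /and3P[BP /negP neq]]]].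
case/existsP=> a /andP[aA /existsP[b /andP[bA /existsP[x /andP[xB]]]]].
case/existsP=> y /andP[yB /and3P[ltax ltxb ltby]]; apply: neq; apply/eqP.
have := nc a x b y ltax ltxb ltby.
rewrite (pblock_block AP aA) (pblock_block AP bA) (pblock_block BP xB).
by rewrite (pblock_block BP yB); apply.
Qed.

End BlockRep.

(** * The partition into level sets of a set of cuts *)

Definition level_partition (N : nat) (S : {set 'I_N}) : {set {set 'I_N.+1}} :=
  preim_partition (fun x : 'I_N.+1 => level S x) [set: 'I_N.+1].

Lemma pblock_preim_eq (T : finType) (rT : eqType) (f : T -> rT) x y :
  (pblock (preim_partition f [set: T]) x == pblock (preim_partition f [set: T]) y)
    = (f x == f y).
Proof.
have partP := preim_partitionP f [set: T].
rewrite eq_pblock ?(cover_partition partP) ?in_setT //; last by case/and3P: partP.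
by rewrite pblock_equivalence_partition // => a b c *; split=> // /eqP->.
Qed.

Lemma preim_partition_eq (T : finType) (rT : eqType) (f : T -> rT)
    (P : {set {set T}}) : partition P [set: T] ->
  (forall x y, (f x == f y) = (pblock P x == pblock P y)) ->
  preim_partition f [set: T] = P.
Proof.
move=> partP fE; rewrite -[RHS](equivalence_partition_pblock partP).
apply: eq_imset => x; apply/setP => y; rewrite !inE fE eq_pblock //.
  by case/and3P: partP.
by rewrite (cover_partition partP) in_setT.
Qed.

Section LevelPartition.
Variables (N : nat) (S : {set 'I_N}).
Hypothesis even_S : ~~ odd #|S|.

Lemma level_partitionP : partition (level_partition S) [set: 'I_N.+1].
Proof. exact: preim_partitionP. Qed.

Lemma pblock_level x y : (pblock (level_partition S) x == pblock (level_partition S) y)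
  = (level S x == level S y).
Proof. exact: pblock_preim_eq. Qed.

(** Equal levels mean that two ranks are equal or add up to [#|S|]. Since ranks are monotone along
    [a < x < b < y], every combination of these cases gives [a] and [x] the same level. *)
Lemma level_partition_nc : non_crossing (level_partition S).
Proof.
apply/(non_crossingP level_partitionP) => a x b y ltax ltxb ltby /eqP eab /eqP exy.
apply/eqP; move: eab exy; rewrite !pblock_level /level.
have := leq_cut_rank S (ltnW ltax); have := leq_cut_rank S (ltnW ltxb).
have := leq_cut_rank S (ltnW ltby); have := cut_rank_max S y.
rewrite -(even_halfK even_S) => ? ? ? ? /eqP ? /eqP ?; apply/eqP; lia.
Qed.

Lemma level_partition_mf : merging_free (level_partition S).
Proof.
set P := level_partition S; have partP : partition P setT := level_partitionP.
apply/merging_freeP => i lti; have lti' := ltnW lti.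
have := block_rep_min_lt partP (ltnSn i) lti.
have: nth set0 (block_rep P) i.+1 \in P by rewrite -mem_block_rep mem_nth.
have: nth set0 (block_rep P) i \in P by rewrite -mem_block_rep mem_nth.
move: (nth _ _ i) (nth _ _ i.+1) => A B AP BP ltAB.
have [x xA ex] := block_min_in (block_neq0 partP AP).
have [y yB ey] := block_min_in (block_neq0 partP BP).
have memP C (u v : 'I_N.+1) : C \in P -> u \in C -> level S u = level S v -> v \in C.
  move=> CP uC e; rewrite -(pblock_block partP CP uC).
  have /eqP -> : pblock P u == pblock P v by rewrite pblock_level e.
  exact: mem_pblock_part.
have ltxy : x < y by rewrite -ex -ey.
have rxy := leq_cut_rank S (ltnW ltxy); have rymax := cut_rank_max S y.
have evS := even_halfK even_S.
case: (ltngtP (level S x) (level S y)) => [ltl | ltl | eql].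
(* [A] is the outer block: its element [z] on the descending side, of complementary rank, comes
   after [y], the minimum of [B]. *)
- have [|z rz] := @cut_rank_surj _ S (#|S| - level S x); first lia.
  have zA : z \in A by apply: (memP A x) => //; rewrite {2}/level rz /level; lia.
  apply: leq_trans (block_max_ge zA); rewrite ey ltnNge; apply/negP => lezy.
  by have := leq_cut_rank S lezy; rewrite rz; move: ltl; rewrite /level; lia.
(* Impossible case: [B] would have an element [z] on the ascending side, of rank less than that of
   [x], hence before its own minimum [y]. *)
- have [|z rz] := @cut_rank_surj _ S (level S y); first by rewrite /level; lia.
  have zB : z \in B by apply: (memP B y) => //; rewrite {2}/level rz /level; lia.
  have := block_min_le zB; rewrite ey => leyz.
  by have := leq_cut_rank S leyz; rewrite rz; move: ltl; rewrite /level; lia.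
- have yA := memP A x y AP xA eql.
  have eAB : A = B by rewrite -(pblock_block partP AP yA) (pblock_block partP BP yB).
  by move: ltAB; rewrite eAB ltnn.
Qed.

(** The levels attained are exactly [0, ..., #|S|./2], and each one contributes one nonempty
    block. *)
Lemma card_level_partition : #|level_partition S| = #|S|./2.+1.
Proof.
pose C (i : 'I_(#|S|./2.+1)) := [set x : 'I_N.+1 | level S x == i].
have -> : level_partition S = C @: [set: 'I_(#|S|./2.+1)].
  apply/setP => A; apply/imsetP/imsetP => [[x _ ->] | [i _ ->]].
    exists (Ordinal (level_max S x : _ < #|S|./2.+1)) => //.
    by apply/setP => y; rewrite !inE eq_sym.
  have [|x lx] := @level_surj _ S even_S i; first by have := ltn_ord i.
  by exists x => //; apply/setP => y; rewrite !inE lx eq_sym.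
rewrite card_imset ?cardsT ?card_ord // => i j eC.
have [|x lx] := @level_surj _ S even_S i; first by have := ltn_ord i.
have : x \in C i by rewrite inE lx.
by rewrite eC inE lx => /eqP /val_inj.
Qed.

End LevelPartition.

(** * Bijection between even sets of cuts and non-crossing merging-free partitions *)

Lemma level_partition_inj (N : nat) :
  {in [pred S : {set 'I_N} | ~~ odd #|S|] &, injective (@level_partition N)}.
Proof.
move=> S T evS evT eST; apply/setP => s.
(* The cuts can be read off the partition: [s] is a cut exactly when the points [s] and [s.+1],
   obtained by [widen_ord] and [lift ord0], lie in different blocks. *)
rewrite -(level_stepE evS) -(level_stepE evT); congr (~~ _).
have := pblock_level S (widen_ord (leqnSn N) s) (lift ord0 s).
by rewrite eST pblock_level /= /bump leq0n add1n => ->.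
Qed.

(** The index of a point's block in [block_rep P] is a nested labelling. Cutting where it changes
    gives a set whose level function is this index, so the level sets are the blocks of [P]. *)
Lemma level_partition_surj (N : nat) (P : {set {set 'I_N.+1}}) :
  P \in nc_merging_free N.+1 -> exists2 S : {set 'I_N}, ~~ odd #|S| & level_partition S = P.
Proof.
rewrite inE => /and3P[partP /(non_crossingP partP) nc /merging_freeP mf].
pose k := size (block_rep P); pose b i := nth set0 (block_rep P) i.
pose f (x : 'I_N.+1) := index (pblock P x) (block_rep P).
(* [inord] extends the index to all of [nat], as the abstract labelling requires; its hypotheses
   concern only arguments up to [N]. *)
pose F x := f (inord x).
have bP i : i < k -> b i \in P by move=> lti; rewrite -mem_block_rep mem_nth.
have bf x : b (f x) = pblock P x by rewrite /b nth_index // mem_block_rep pblock_in_part.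
have fE x y : (f x == f y) = (pblock P x == pblock P y).
  by apply/eqP/eqP => [e | ]; [rewrite -!bf e | rewrite /f => ->].
have ltf x : f x < k by rewrite index_mem mem_block_rep pblock_in_part.
have fb i x : i < k -> x \in b i -> f x = i.
  move=> lti xb; rewrite /f (pblock_block partP (bP i lti) xb).
  by rewrite index_uniq ?block_rep_uniq.
have Fval (x : 'I_N.+1) : F x = f x by rewrite /F inord_val.
have F_bound x : x <= N ->
    [/\ F x < k, block_min (b (F x)) <= x & x <= block_max (b (F x))].
  move=> lex; have xb : inord x \in b (F x) by rewrite bf mem_pblock_part.
  by split; [exact: ltf | have := block_min_le xb | have := block_max_ge xb];
    rewrite inordK.
have m_label i : i < k -> block_min (b i) <= N /\ F (block_min (b i)) = i.
  move=> lti; have [y yb ->] := block_min_in (block_neq0 partP (bP i lti)).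
  by rewrite Fval (fb i) // -ltnS ltn_ord.
have M_label i : i < k -> block_max (b i) <= N /\ F (block_max (b i)) = i.
  move=> lti; have [y yb ->] := block_max_in (block_neq0 partP (bP i lti)).
  by rewrite Fval (fb i) // -ltnS ltn_ord.
have F_nc a x c y : a < x -> x < c -> c < y -> y <= N -> F a = F c -> F x = F y -> F a = F x.
  move=> ltax ltxc ltcy ley /eqP; rewrite fE => /eqP eac /eqP; rewrite fE => /eqP exy.
  by apply/eqP; rewrite fE; apply/eqP; apply: nc eac exy; rewrite !inordK //; lia.
pose S := [set s : 'I_N | F s != F s.+1].
have [|||evS lS] := nested_level F_bound m_label M_label _ _ F_nc (S := S).
- by move=> i j ltij ltj; apply: (block_rep_min_lt partP).
- exact: mf.
- by move=> s; rewrite inE.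
exists S => //; apply: preim_partition_eq => // x y.
by rewrite !lS ?Fval ?fE // -ltnS.
Qed.

(** * The image of the even sets of cuts and its generating polynomial *)

Local Open Scope ring_scope.

Lemma nc_merging_free_imset (N : nat) :
  nc_merging_free N.+1 = @level_partition N @: [set S : {set 'I_N} | ~~ odd #|S|].
Proof.
apply/setP => P; apply/idP/imsetP => [/level_partition_surj[S evS <-] | [S]].
  by exists S; rewrite ?inE.
rewrite !inE => evS ->.
by rewrite level_partitionP level_partition_nc // level_partition_mf.
Qed.

Lemma sum_even_sets (N : nat) :
  \sum_(S : {set 'I_N} | ~~ odd #|S|) 'X^(#|S|./2.+1)
  = \sum_(0 <= t < N./2.+1) ('C(N, 2 * t))%:R *: 'X^(t.+1) :> {poly int}.
Proof.
rewrite big_mkord.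
(* Even sets are grouped by half their size [t]; [inord] is faithful here since [#|S|./2 <= N./2].
   Class [t] consists of the subsets of size [2 * t]. *)
rewrite (partition_big (fun S : {set 'I_N} => inord #|S|./2 : 'I_(N./2.+1)) predT) //=.
apply: eq_bigr => t _.
have hS (S : {set 'I_N}) : (~~ odd #|S| && (inord #|S|./2 == t)) = (#|S| == 2 * t)%N.
  have leS : (#|S| <= N)%N by have := max_card S; rewrite card_ord.
  rewrite -val_eqE /= inordK; last by rewrite ltnS half_leq.
  by rewrite mul2n -{3}(odd_double_half #|S|); case: odd => /=; lia.
rewrite (eq_bigl _ _ hS).
transitivity (\sum_(S in [set A : {set 'I_N} | #|A| == 2 * t]%N) 'X^(t.+1) : {poly int}).
  by apply: eq_big => S; rewrite ?inE // => /eqP->; rewrite mul2n doubleK.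
by rewrite sumr_const card_draws card_ord scaler_nat.
Qed.

Unset Implicit Arguments.

Theorem theorem37 (n : nat) (hn : (1 <= n)%N) :
  \sum_(P in nc_merging_free n) 'X^(blocks P)
  = \sum_(1 <= t < ((n + 1) %/ 2).+1)
      ('C(n - 1, 2 * (t - 1)))%:R *: 'X^t :> {poly int}.
Proof.
case: n hn => // N _.
rewrite nc_merging_free_imset big_imset /=; last first.
  by move=> S T; rewrite !inE; apply: level_partition_inj.
under eq_bigr => S evS.
  rewrite inE in evS.
  rewrite /blocks card_level_partition //.
  over.
under eq_bigl => S do rewrite inE.
(* For [n = N.+1] the upper bound [(n + 1) %/ 2] is [N./2.+1], and shifting the index by 1 turns
   [2 * (t - 1)] into [2 * t]. *)
rewrite sum_even_sets big_add1 /= addn1 divn2 /= subn1 /=.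
by apply: eq_bigr => t _; rewrite subn1.
Qed.
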